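(* Let $X$ be a finite set and let $\theta:[t_1,\infty)\to\Pi_X$ be a sequence of partitions of $X$, with associated complexes $K^{s,t}$ and Hilbert function $\mathrm{HF}_0$. (i) For every interval $[s,t]\subseteq[t_1,\infty)$, $\mathrm{HF}_0(s,t)\le \min_{r\in[s,t]}|\theta(r)|$. (ii) $\mathrm{HF}_0(s,t)<\min_{r\in[s,t]}|\theta(r)|$ if and only if $\theta$ has a 0-conflict in $[s,t]$. (iii) For $r\in[s,t]$, $\mathrm{HF}_0(s,t)=|\theta(r)|$ if and only if $\theta(r)$ is the maximum of the subposet $\theta([s,t])\subseteq(\Pi_X,\le)$.
   Context: $X=\{x_1,\dots,x_N\}$ is a finite set, $\Pi_X$ is the set of partitions of $X$ (into nonempty clusters), and $|\pi|$ is the number of clusters of $\pi$. Refinement order: $\pi\le\pi'$ if every cluster of $\pi$ is contained in a cluster of $\pi'$. A sequence of partitions is a piecewise-constant map $\theta:[t_1,\infty)\to\Pi_X$ with change points $t_1<\dots<t_M$: $\theta(t)=\theta(t_m)$ for $t\in[t_m,t_{m+1})$, $1\le m\le M-1$, and $\theta(t)=\theta(t_M)$ for $t\ge t_M$. For $t_1\le s\le t$, $K^{s,t}:=\bigcup_{s\le r\le t}\bigcup_{C\in\theta(r)}\Delta C$, where $\Delta C:=2^C$ is the solid simplex on $C$ (an abstract simplicial complex on $X$). $\mathrm{HF}_k(s,t):=\dim H_k(K^{s,t})$, where $H_k$ is simplicial homology with coefficients in a fixed field; in particular $\mathrm{HF}_0(s,t)$ is the number of connected components of $K^{s,t}$.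 $\theta$ has a 0-conflict in $[s,t]$ if the subposet $\theta([s,t])$ of $(\Pi_X,\le)$ has no maximum, i.e. there is no $r\in[s,t]$ with $\theta(r')\le\theta(r)$ for all $r'\in[s,t]$. *)

(* Defs.v *)
From HB Require Import structures.
From mathcomp Require Import all_boot all_order all_algebra.
From mathcomp Require Import boolp reals.

Set Implicit Arguments.
Unset Strict Implicit.
Unset Printing Implicit Defensive.

Import Order.TTheory GRing.Theory Num.Theory.
Local Open Scope ring_scope.

(* Unreduced simplicial homology over a field F.  An abstract simplicial
   complex on X is a downward closed K : {set {set X}}; it may contain the
   empty face, which carries no chains.  Chains are coefficient families
   indexed by all subsets of X, the subspace of k-chains of K being spanned by
   the faces with k + 1 vertices, oriented by the enumeration order of X. *)
Section Homology.
Variables (F : fieldType) (X : finType).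

Local Notation chain := {ffun {set X} -> F^o}.

Definition face_chain (A : {set X}) : chain := [ffun B => (B == A)%:R].

Definition position (A : {set X}) (v : X) : nat :=
  #|[set w in A | enum_rank w < enum_rank v]|%N.

(* Omitting the summand whose face is empty makes the boundary of a vertex 0. *)
Definition face_boundary (A : {set X}) : chain :=
  \sum_(v in A | A :\ v != set0) (-1) ^+ position A v *: face_chain (A :\ v).

Definition boundary_fun (c : chain) : chain := \sum_A c A *: face_boundary A.

Fact boundary_fun_is_linear : linear boundary_fun.
Proof.
move=> a c d; rewrite /boundary_fun scaler_sumr -big_split /=.
by apply: eq_bigr => A _; rewrite !ffunE scalerDl scalerA.
Qed.

HB.instance Definition _ :=
  GRing.isLinear.Build F chain chain _ boundary_fun boundary_fun_is_linear.

Definition boundary : 'End(chain) := linfun boundary_fun.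

Variable K : {set {set X}}.

Definition chains (k : nat) : {vspace chain} :=
  <<[seq face_chain A | A : {set X} <- enum K & #|A| == k.+1]>>%VS.

Definition cycles (k : nat) : {vspace chain} := (chains k :&: lker boundary)%VS.

Definition boundaries (k : nat) : {vspace chain} := (boundary @: chains k.+1)%VS.

(* dim H_k = dim (Z_k / B_k); B_k is a subspace of Z_k by
   [boundaries_sub_cycles] below. *)
Definition dim_homology (k : nat) : nat := (\dim (cycles k) - \dim (boundaries k))%N.

End Homology.

Section HomologyFacts.
Variables (F : fieldType) (X : finType).
Implicit Types (A B : {set X}) (K : {set {set X}}).

Lemma boundary_face A : boundary F X (face_chain F A) = face_boundary F A.
Proof.
rewrite lfunE /= /boundary_fun (bigD1 A) //= ffunE eqxx scale1r big1 ?addr0 //.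
by move=> B nBA; rewrite ffunE (negPf nBA) scale0r.
Qed.

Lemma position_D1 A v w : v \in A -> w \in A -> v != w ->
  position A w = ((enum_rank v < enum_rank w)%N + position (A :\ v) w)%N.
Proof.
move=> vA wA vw; rewrite /position (cardsD1 v) !inE vA /=; congr (_ + _)%N.
by apply: eq_card => u; rewrite !inE andbA.
Qed.

Lemma boundary_boundary A : boundary F X (face_boundary F A) = 0.
Proof.
pose P (v w : X) := [&& v \in A, w \in A, v != w & A :\ v :\ w != set0].
pose T (v w : X) : {ffun {set X} -> F^o} :=
  ((-1) ^+ (position A v + position (A :\ v) w)) *: face_chain F (A :\ v :\ w).
have -> : boundary F X (face_boundary F A) = \sum_v \sum_(w | P v w) T v w.
  rewrite /face_boundary linear_sum /= big_mkcond /=; apply: eq_bigr => v _.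
  case: ifP => [/andP[vA _]|vA]; last first.
    rewrite big1 // => w /and4P[vA' wA vw ne]; move: vA; rewrite vA' /=.
    by move/negbFE/eqP => A0; move: ne; rewrite A0 set0D eqxx.
  rewrite linearZ /= boundary_face /face_boundary scaler_sumr; apply: eq_big => w.
    by rewrite /P in_setD1 vA /= [w == v]eq_sym -andbA andbCA.
  by move=> _; rewrite scalerA -exprD.
have TC v w : P v w -> T w v = - T v w.
  move=> /and4P[vA wA vw _]; rewrite /T.
  rewrite (position_D1 vA wA vw) (@position_D1 A w v) // 1?eq_sym //.
  have -> : A :\ w :\ v = A :\ v :\ w by apply/setP => u; rewrite !inE andbCA.
  rewrite -scaleNr; congr (_ *: _).
  have : enum_rank v != enum_rank w by rewrite (inj_eq enum_rank_inj).
  rewrite -val_eqE /=; case: ltngtP => //= _ _.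
    by rewrite add0n add1n addSn exprS mulN1r addnC.
  by rewrite add0n add1n addSn exprS mulN1r opprK addnC.
have PC v w : P w v = P v w.
  have -> : P w v = [&& w \in A, v \in A, w != v & A :\ w :\ v != set0] by [].
  have -> : A :\ w :\ v = A :\ v :\ w by apply/setP => u; rewrite !inE andbCA.
  by rewrite andbCA eq_sym.
pose lt (v w : X) := (enum_rank v < enum_rank w)%N.
under eq_bigr => v _ do rewrite (bigID (lt v)) /=.
rewrite big_split /=; apply/eqP; rewrite addrC addr_eq0; apply/eqP.
under eq_bigr => v _ do rewrite big_mkcond.
rewrite exchange_big /= -sumrN.
apply: eq_bigr => v _; rewrite -big_mkcond -sumrN; apply: eq_big => w.
  rewrite PC /lt; case Pvw: (P v w) => //=.
  case/and4P: Pvw => _ _ vw _; rewrite -leqNgt leq_eqVlt val_eqE (inj_eq enum_rank_inj).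
  by rewrite (negPf vw).
by case/andP=> Pwv _; apply: TC; rewrite PC.
Qed.

Lemma boundaries_sub_cycles K k :
  (forall A B, A \in K -> B \subset A -> B \in K) ->
  (boundaries F K k <= cycles F K k)%VS.
Proof.
move=> Kdown; rewrite /boundaries /cycles /chains limg_span.
apply/span_subvP => _ /mapP[_ /mapP[A + ->] ->].
rewrite mem_filter mem_enum => /andP[/eqP cA AK].
rewrite boundary_face memv_cap memv_ker boundary_boundary eqxx andbT.
rewrite memv_suml // => v /andP[vA _]; rewrite memvZ //.
apply/memv_span/map_f; rewrite mem_filter mem_enum (Kdown A) ?subD1set // andbT.
by move: cA; rewrite (cardsD1 v) vA add1n => -[->].
Qed.

End HomologyFacts.

Notation set_partition X := {P : {set {set X}} | partition P [set: X]}.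

Section SequencesOfPartitions.
Variables (R : realType) (X : finType).

Definition refines (P Q : set_partition X) : bool :=
  [forall C in val P, exists D in val Q, C \subset D].

(* theta is only meaningful on [t1, +oo[. The change points are
   t1 :: ts, and change m is the (m+1)-st of them. *)
Definition partition_sequence (t1 : R) (theta : R -> set_partition X) : Prop :=
  exists ts : seq R, let change := nth t1 (t1 :: ts) in
  [/\ sorted <%R (t1 :: ts),
      forall m t, (m < size ts)%N -> change m <= t < change m.+1 ->
        theta t = theta (change m)
    & forall t, change (size ts) <= t -> theta t = theta (change (size ts))].

Variable theta : R -> set_partition X.

Definition values (s t : R) : {set set_partition X} :=
  [set P | `[< exists2 r, s <= r <= t & theta r = P >]].

Definition interval_complex (s t : R) : {set {set X}} :=
  \bigcup_(P in values s t) \bigcup_(C in val P) powerset C.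

Definition HF (F : fieldType) (k : nat) (s t : R) : nat :=
  dim_homology F (interval_complex s t) k.

(* For s <= t, the initial value #|theta s| is one of the minimised values. *)
Definition min_clusters (s t : R) : nat :=
  \big[minn/#|val (theta s)|]_(P in values s t) #|val P|.

Definition is_maximum (P : set_partition X) (S : {set set_partition X}) : Prop :=
  P \in S /\ forall Q, Q \in S -> refines Q P.

Definition has_0_conflict (s t : R) : Prop :=
  ~ exists P, is_maximum P (values s t).

End SequencesOfPartitions.

(* Main.v *)
From HB Require Import structures.
Require Import Defs.
From mathcomp Require Import all_boot all_order all_algebra.
From mathcomp Require Import boolp reals.

Set Implicit Arguments.
Unset Strict Implicit.

Import Order.TTheory GRing.Theory Num.Theory.
Local Open Scope ring_scope.

(** Comparing a complex with a partition reduces to comparing subspaces of the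
    space [Z] of 0-chains, without ever computing connected components.  For a
    partition [P] of [X], collapsing every vertex to its cluster is a linear map
    on [Z] whose image has dimension [#|P|]; let [B_P] be its kernel, which is
    spanned by the differences of two vertices of the same cluster.  Thus
    [\dim Z = #|P| + \dim B_P].

    Let [K] be a complex that contains the clusters of [P], and let [B] be the
    space of its 0-boundaries, spanned by the differences of adjacent vertices.
    Two vertices of a cluster are adjacent in [K], so [B_P] lies in [B], whence
    [dim H_0 K = \dim Z - \dim B <= \dim Z - \dim B_P = #|P|].  Equality means
    that [B = B_P], that is, that the collapsing map kills [B], that is, that
    every edge of [K] joins two vertices of the same cluster of [P]
    ([dim_homology0_leqif]).

    The edges of the interval complex are the pairs inside some cluster of some
    value [Q] of [theta], so the last condition says that every [Q] refines [P].
    This is the bound with its equality case for each value [P]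
    ([HF0_le_eq_maximum]); the claims about the minimum follow, since the minimum
    of [#|P|] is attained by some value. *)

(** * Zeroth homology against a partition *)

Section ZerothHomology.
Variables (F : fieldType) (X : finType).
Implicit Types (x y : X) (A C : {set X}) (K P : {set {set X}}).

Local Notation chain := {ffun {set X} -> F^o}.
Local Notation face := (@face_chain F X).
Local Notation vertex x := (face [set x]).

Lemma dim_span_face_chains (s : seq {set X}) :
  uniq s -> \dim <<[seq face A | A <- s]>>%VS = size s.
Proof.
move=> s_uniq; rewrite -(size_map face s); apply/eqP.
have /freeP free_s : forall k : 'I_(size s) -> F,
    \sum_i k i *: (map_tuple face (in_tuple s))`_i = 0 ->
    forall i, k i = 0.
  move=> k k0 i.
  have /ffunP/(_ (nth set0 s i)) := k0.
  rewrite ffunE sum_ffunE (bigD1 i) //= big1 ?addr0.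
    by rewrite !ffunE (nth_map set0) // !ffunE eqxx [_ *: _]mulr1.
  move=> j ji; rewrite !ffunE (nth_map set0) // ffunE nth_uniq //.
  by rewrite eq_sym -val_eqE in ji *; rewrite (negPf ji) scaler0.
exact: free_s.
Qed.

Lemma face_boundary_vertex x : face_boundary F [set x] = 0.
Proof.
rewrite /face_boundary big1 // => v /andP[/set1P->].
by rewrite setDv eqxx.
Qed.

(** The sign depends on which endpoint comes first in the enumeration of [X];
    only the line spanned by the boundary matters below. *)
Lemma face_boundary_edge x y : x != y ->
  exists e : nat,
    face_boundary F [set x; y] = (-1) ^+ e *: (vertex x - vertex y).
Proof.
move=> xy.
have D2 (v w : X) : v != w -> [set v; w] :\ v = [set w].
  by move=> vw; rewrite setU1K // inE.
have Dx := D2 _ _ xy; have Dy : [set x; y] :\ y = [set x].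
  by rewrite setUC D2 // eq_sym.
have pos (v w : X) : v != w -> position [set w; v] v = (enum_rank w < enum_rank v)%N.
  move=> vw; rewrite (@position_D1 _ _ w v) ?inE ?eqxx ?orbT // 1?eq_sym //.
  rewrite D2 1?eq_sym // (_ : position [set v] v = 0%N) ?addn0 //.
  by apply: eq_card0 => u; rewrite !inE; case: eqP => //= ->; rewrite ltnn.
exists (position [set x; y] y).
rewrite /face_boundary big_mkcondr big_setU1 ?inE //= big_set1 Dx Dy.
rewrite -!card_gt0 !cards1 /= pos 1?eq_sym // [in position _ x]setUC pos //.
rewrite scalerBr addrC; congr (_ + _); rewrite -scaleNr; congr (_ *: _).
have : enum_rank x != enum_rank y by rewrite (inj_eq enum_rank_inj).
by rewrite -val_eqE /=; case: ltngtP; rewrite ?expr0 ?expr1 ?opprK.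
Qed.

Lemma chains0E K : (forall x, [set x] \in K) ->
  chains F K 0 = <<[seq vertex x | x : X]>>%VS.
Proof.
move=> K1; apply/eq_span => c; apply/mapP/mapP => -[].
  move=> A; rewrite mem_filter => /andP[/cards1P[x ->] _] ->.
  by exists x; rewrite ?mem_enum.
move=> x _ ->; exists [set x] => //.
by rewrite mem_filter cards1 mem_enum K1.
Qed.

Lemma cycles0E K : cycles F K 0 = chains F K 0.
Proof.
apply/capv_idPl/span_subvP => _ /mapP[A + ->].
rewrite mem_filter => /andP[/cards1P[x ->] _].
by rewrite memv_ker boundary_face face_boundary_vertex.
Qed.

Lemma vertex_sub_boundary K x y :
  [set x; y] \in K -> vertex x - vertex y \in boundaries F K 0.
Proof.
move=> xyK; have [->|xy] := eqVneq x y; first by rewrite subrr mem0v.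
have [e edge_xy] := face_boundary_edge xy.
rewrite -[_ - _]scale1r -(signrMK e 1) mulr1 -scalerA -edge_xy memvZ //.
rewrite -boundary_face memv_img //; apply/memv_span/map_f.
by rewrite mem_filter mem_enum cards2 xy xyK.
Qed.

(** A 0-chain is pushed to the clusters of [P] by giving each cluster the sum
    of the coefficients of its vertices.  The face chain of a cluster serves as
    the basis vector naming that cluster, whatever its number of vertices. *)
Definition collapse_fun P (c : chain) : chain :=
  \sum_x c [set x] *: face (pblock P x).

Fact collapse_fun_is_linear P : linear (collapse_fun P).
Proof.
move=> a c d; rewrite /collapse_fun scaler_sumr -big_split /=.
by apply: eq_bigr => x _; rewrite !ffunE scalerDl scalerA.
Qed.

HB.instance Definition _ P :=
  GRing.isLinear.Build F chain chain _ (collapse_fun P)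
    (collapse_fun_is_linear P).

Definition collapse P : 'End(chain) := linfun (collapse_fun P).

Lemma collapse_vertex P x :
  collapse P (vertex x) = face (pblock P x).
Proof.
rewrite lfunE /= /collapse_fun (bigD1 x) //= ffunE eqxx scale1r big1 ?addr0 //.
by move=> y yx; rewrite ffunE (inj_eq set1_inj) (negPf yx) scale0r.
Qed.

Lemma face_chain_inj : injective face.
Proof.
move=> A B /ffunP/(_ A); rewrite !ffunE eqxx; case: eqP => // _ /eqP.
by rewrite oner_eq0.
Qed.

Section PartitionIntoFaces.
Variables K P : {set {set X}}.
Hypothesis Kdown : forall A B : {set X}, A \in K -> B \subset A -> B \in K.
Hypothesis Ppart : partition P [set: X].
Hypothesis PK : P \subset K.

Let Pcover x : x \in cover P.
Proof. by rewrite (cover_partition Ppart). Qed.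

Let K1 x : [set x] \in K.
Proof.
apply: (@Kdown (pblock P x)); last by rewrite sub1set mem_pblock.
by rewrite (subsetP PK) // pblock_mem.
Qed.

Let tiP : trivIset P. Proof. by case/and3P: Ppart. Qed.

Lemma dim_limg_collapse : \dim (collapse P @: chains F K 0) = #|P|.
Proof.
rewrite chains0E // limg_span -map_comp cardE.
rewrite -(dim_span_face_chains (enum_uniq P)); congr (\dim _).
apply/eq_span => c; apply/mapP/mapP => -[].
  move=> x _ -> /=; rewrite collapse_vertex.
  by exists (pblock P x); rewrite // mem_enum pblock_mem.
move=> C; rewrite mem_enum => CP ->.
have /set0Pn[x xC] : C != set0.
  by apply: contraTneq CP => ->; case/and3P: Ppart.
exists x; rewrite ?mem_enum //= collapse_vertex.
by rewrite (def_pblock tiP CP xC).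
Qed.

(** With one vertex chosen in each cluster, every vertex is the chosen vertex
    of its cluster plus an edge boundary killed by the collapse.  Hence the
    subspace [B :&: lker (collapse P)] has codimension at most [#|P|] in the
    0-chains, which is the codimension of the whole kernel. *)
Lemma ker_collapse_sub_boundaries :
  (chains F K 0 :&: lker (collapse P) <= boundaries F K 0)%VS.
Proof.
pose B := boundaries F K 0; pose Z := chains F K 0; pose L := lker (collapse P).
pose rep C : chain := if [pick x in C] is Some x then vertex x else 0.
have BZ : (B <= Z)%VS by rewrite /Z -cycles0E boundaries_sub_cycles.
have Z_sub : (Z <= B :&: L + <<map rep (enum P)>>)%VS.
  rewrite /Z chains0E //; apply/span_subvP => _ /mapP[x _ ->].
  have xx : x \in pblock P x by rewrite mem_pblock.
  have PxP : pblock P x \in P by rewrite pblock_mem.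
  have : rep (pblock P x) \in <<map rep (enum P)>>%VS.
    by apply/memv_span/map_f; rewrite mem_enum.
  rewrite /rep; case: pickP => [y yx | /(_ x)]; last by rewrite xx.
  move=> repP; rewrite -[vertex x](subrK (vertex y)) memv_add //.
  rewrite memv_cap vertex_sub_boundary /=; last first.
    by rewrite (@Kdown (pblock P x)) ?(subsetP PK) // subUset !sub1set xx.
  rewrite memv_ker linearB /= !collapse_vertex subr_eq0.
  by rewrite (def_pblock tiP PxP yx).
have U_sub : (B :&: L <= Z :&: L)%VS by apply: capvS.
suff /eqP <- : (B :&: L == Z :&: L)%VS by apply: capvSl.
rewrite -(geq_leqif (dimv_leqif_eq U_sub)).
rewrite -(leq_add2r #|P|) -{1}dim_limg_collapse limg_ker_dim.
apply: leq_trans (dimvS Z_sub) _; apply: leq_trans (dimv_add_leqif _ _) _.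
by rewrite leq_add2l (leq_trans (dim_span _)) // size_map -cardE.
Qed.

(** The collapse sends the boundary of an edge to a difference of two cluster
    basis vectors, up to sign, which vanishes exactly when the clusters agree. *)
Lemma boundaries_sub_ker_collapse :
  (boundaries F K 0 <= lker (collapse P))%VS =
  [forall x, forall y, ([set x; y] \in K) ==> (pblock P x == pblock P y)].
Proof.
apply/idP/forallP => [B_sub x | edgeP].
  apply/forallP => y; apply/implyP => xyK.
  have /(subvP B_sub) := vertex_sub_boundary xyK.
  rewrite memv_ker linearB /= !collapse_vertex subr_eq0.
  by rewrite (inj_eq face_chain_inj).
rewrite /boundaries /chains limg_span; apply/span_subvP => _ /mapP[c + ->].
case/mapP=> A; rewrite mem_filter mem_enum => /andP[/cards2P[x [y [xy ->]]] xyK] ->.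
have [e edge_xy] := face_boundary_edge xy.
rewrite boundary_face edge_xy memvZ // memv_ker linearB /= !collapse_vertex.
by have /forallP/(_ y)/implyP/(_ xyK)/eqP-> := edgeP x; rewrite subrr.
Qed.

(** Rank and nullity of the collapse turn the inclusion of its kernel in the
    0-boundaries into the bound, and equality of these subspaces into equality
    of dimensions. *)
Lemma dim_homology0_leqif :
  (dim_homology F K 0 <= #|P| ?= iff
   [forall x, forall y, ([set x; y] \in K) ==> (pblock P x == pblock P y)])%N.
Proof.
have BZ : (boundaries F K 0 <= chains F K 0)%VS.
  by rewrite -(cycles0E K) boundaries_sub_cycles.
rewrite -boundaries_sub_ker_collapse /dim_homology cycles0E.
have <- : ((chains F K 0 :&: lker (collapse P)) == boundaries F K 0)%VS =
          (boundaries F K 0 <= lker (collapse P))%VS.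
  by rewrite eqEsubv ker_collapse_sub_boundaries subv_cap BZ.
have [le_dim <-] := dimv_leqif_eq ker_collapse_sub_boundaries.
have dimZ := limg_ker_dim (collapse P) (chains F K 0).
rewrite dim_limg_collapse in dimZ.
have := dimvS BZ; rewrite -dimZ => leZ; split.
  by rewrite leq_subLR leq_add2r.
by rewrite -(eqn_add2r (\dim (boundaries F K 0))) subnK // addnC eqn_add2l.
Qed.

End PartitionIntoFaces.
End ZerothHomology.

(** * Interval complexes *)

Section IntervalComplex.
Variables (R : realType) (F : fieldType) (X : finType).
Variables (theta : R -> set_partition X) (s t : R).
Implicit Types (P Q : set_partition X) (A : {set X}).

Local Notation K := (interval_complex theta s t).
Local Notation V := (values theta s t).

Lemma mem_interval_complex A :
  reflect (exists2 Q, Q \in V & exists2 C, C \in val Q & A \subset C) (A \in K).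
Proof.
apply: (iffP bigcupP) => [[Q QV /bigcupP[C CQ]] | [Q QV [C CQ AC]]].
  by rewrite powersetE => AC; exists Q => //; exists C.
by exists Q => //; apply/bigcupP; exists C; rewrite ?powersetE.
Qed.

Lemma mem_values r : s <= r <= t -> theta r \in V.
Proof. by move=> r_st; rewrite inE; apply/asboolP; exists r. Qed.

(** Refinement is visible on edges: for a vertex [x] of a cluster [C] of [Q],
    every other vertex of [C] is joined to [x] by an edge of [K], so [C] lies in
    the cluster of [x] in [P] as soon as all edges of [K] at [x] do. *)
Lemma values_refineP P :
  reflect (forall Q, Q \in V -> refines Q P)
    [forall x, forall y, ([set x; y] \in K) ==>
       (pblock (val P) x == pblock (val P) y)].
Proof.
have Pcover x : x \in cover (val P) by rewrite (cover_partition (valP P)).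
have /and3P[_ tiP _] := valP P.
apply: (iffP forallP) => [edgeP Q QV | refP x].
  apply/forall_inP => C CQ; have /and3P[_ _ Q0] := valP Q.
  have /set0Pn[x xC] : C != set0 by apply: contraTneq CQ => ->.
  apply/exists_inP; exists (pblock (val P) x); first by rewrite pblock_mem.
  apply/subsetP => y yC; have /forallP/(_ y)/implyP := edgeP x.
  move=> /(_ _)/eqP->; first by rewrite mem_pblock.
  apply/mem_interval_complex; exists Q => //; exists C => //.
  by rewrite subUset !sub1set xC.
apply/forallP => y; apply/implyP => /mem_interval_complex[Q QV [C CQ]].
rewrite subUset !sub1set => /andP[xC yC].
have /forall_inP/(_ C CQ)/exists_inP[D DP /subsetP CD] := refP Q QV.
by rewrite !(def_pblock tiP DP) ?CD.
Qed.

Lemma HF0_le_eq_maximum P : P \in V ->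
  (HF theta F 0 s t <= #|val P|)%N /\
  (HF theta F 0 s t = #|val P| <-> is_maximum P V).
Proof.
move=> PV; have Kdown (A B : {set X}) : A \in K -> B \subset A -> B \in K.
  move=> /mem_interval_complex[Q QV [C CQ AC]] BA.
  apply/mem_interval_complex; exists Q => //; exists C => //.
  exact: subset_trans BA AC.
have PK : val P \subset K.
  apply/subsetP => C CP; apply/mem_interval_complex.
  by exists P => //; exists C.
have [leP eqP_max] := dim_homology0_leqif F Kdown (valP P) PK.
split=> //; rewrite /HF; split=> [/eqP | [_ /values_refineP maxP]].
  by rewrite eqP_max => /values_refineP.
by apply/eqP; rewrite eqP_max.
Qed.

Lemma min_clusters_le P : P \in V -> (min_clusters theta s t <= #|val P|)%N.
Proof. by move=> PV; rewrite /min_clusters -minEnat -leEnat bigmin_le_cond. Qed.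

Lemma min_clusters_attained : s <= t ->
  exists2 P, P \in V & min_clusters theta s t = #|val P|.
Proof.
move=> st; rewrite /min_clusters.
elim/big_ind: _ => [|m n [P PV ->] [Q QV ->]|P PV]; last by exists P.
  by exists (theta s) => //; rewrite mem_values ?lexx.
by rewrite /minn; case: ifP => _; [exists P | exists Q].
Qed.

End IntervalComplex.

Unset Implicit Arguments.

Theorem proposition7 (R : realType) (F : fieldType) (X : finType) (t1 : R)
    (theta : R -> set_partition X) (htheta : partition_sequence t1 theta) :
  (forall s t : R, t1 <= s -> s <= t ->
     (HF theta F 0 s t <= min_clusters theta s t)%N)
  /\ (forall s t : R, t1 <= s -> s <= t ->
     (HF theta F 0 s t < min_clusters theta s t)%N <-> has_0_conflict theta s t)
  /\ (forall s t r : R, t1 <= s -> s <= t -> s <= r <= t ->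
     HF theta F 0 s t = #|val (theta r)|
       <-> is_maximum (theta r) (values theta s t)).
Proof.
have HF_le s t : s <= t -> (HF theta F 0 s t <= min_clusters theta s t)%N.
  move=> st; have [P PV ->] := min_clusters_attained theta st.
  by have [] := HF0_le_eq_maximum F PV.
split; first by move=> s t _; apply: HF_le.
split=> [s t _ st | s t r _ _ r_st]; last first.
  by have [] := HF0_le_eq_maximum F (mem_values theta r_st).
split=> [lt_min [P maxP] | conflict].
  have PV := maxP.1.
  have [_ /iffRL/(_ maxP) HF_P] := HF0_le_eq_maximum F PV.
  by move: lt_min; rewrite HF_P ltnNge min_clusters_le.
rewrite ltn_neqAle HF_le // andbT; apply/eqP.
have [P PV ->] := min_clusters_attained theta st.
have [_ /iffLR HF_P] := HF0_le_eq_maximum F PV.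
by move/HF_P => maxP; apply: conflict; exists P.
Qed.
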